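(* Let $q$ be a prime power with $q=ef+1=\epsilon\rho+1$, where $e,f,\epsilon,\rho>1$ are integers and $\epsilon\mid e$. (a) Let $q\equiv 1\pmod{2\epsilon}$ and suppose $\phi_1=\phi_j$ for all $1\le j\le\epsilon-1$. Then: (i) if $f$ is odd, $\phi_0=2\psi_0$ and $\phi_1=2\psi_1$; (ii) if $f$ is even and $\epsilon>2$, $\phi_0=2\psi_0+1$ and $\phi_1=2\psi_1$; (iii) if $f$ is even, $\epsilon=2$ and $q\equiv 1\pmod 8$, $\phi_0=2\psi_0+1$ and $\phi_1=2\psi_1$; (iv) if $f$ is even, $\epsilon=2$ and $q\equiv 5\pmod 8$, $\phi_0=2\psi_0$ and $\phi_1=2\psi_1+1$. (b) Let $q\equiv\epsilon+1\pmod{2\epsilon}$ with $\epsilon$ odd, and suppose $\phi_1=\phi_j$ for all $1\le j\le\epsilon-1$. Then $\phi_0=2\psi_0$ and $\phi_1=2\psi_1$. (c) Let $q\equiv\epsilon+1\pmod{2\epsilon}$ with $\epsilon$ even. Then $\phi_0=\phi_{\epsilon/2}$.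
   Context: Let $\alpha$ be a fixed primitive element of $GF(q)$. For a divisor $d$ of $q-1$ and $0\le i\le d-1$, the cyclotomic class of order $d$ is $C_i^d=\alpha^i\langle\alpha^d\rangle$. For $0\le i\le\epsilon-1$ define $\Phi_i=\{x\in C_0^e: x\neq 1,\ x-1\in\alpha^iC_0^\epsilon\}$ and $\phi_i=|\Phi_i|$, and $\Psi_i=\{r: 1\le r<f/2,\ \alpha^{re}\in\Phi_i\}$ and $\psi_i=|\Psi_i|$. *)

(* Defs.v *)
From mathcomp Require Import all_boot all_algebra fingroup cyclic.

Set Implicit Arguments.
Unset Strict Implicit.
Unset Printing Implicit Defensive.

Import GRing.Theory.
Local Open Scope ring_scope.

Section Cyclotomy.

Variables (F : finFieldType) (alpha : {unit F}).

Definition primitive_element : bool := generator [set: {unit F}] alpha.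

Definition cyclotomic_class (d i : nat) : {set F} :=
  [set FinRing.uval (alpha ^+ i * u)%g | u in <[(alpha ^+ d)%g]>%g].

Definition Phi (e eps i : nat) : {set F} :=
  [set x in cyclotomic_class e 0 | (x != 1)
    & (x - 1 \in [set FinRing.uval alpha ^+ i * y
                  | y in cyclotomic_class eps 0])].

Definition phi (e eps i : nat) : nat := #|Phi e eps i|.

(* r < f / 2 with an exact (not truncated) half is expressed as 2 * r < f;
   indexing r by 'I_f loses nothing. *)
Definition Psi (e f eps i : nat) : {set 'I_f} :=
  [set r : 'I_f | (1 <= r)%N && (2 * r < f)%N
    & FinRing.uval alpha ^+ (r * e) \in Phi e eps i].

Definition psi (e f eps i : nat) : nat := #|Psi e f eps i|.

End Cyclotomy.

(* Main.v *)
Require Import Defs.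
From mathcomp Require Import all_boot all_algebra fingroup cyclic.
From mathcomp Require Import finfield zify ring.

(** Write [w] for [alpha ^ rho], a primitive [eps]-th root of unity. Then
    [Phi_i] is the set of [x] with [x ^ f = 1] and [(x - 1) ^ rho = w ^ i].
    Since [f] divides [rho], replacing [x] by its inverse multiplies [(x - 1)
    ^ rho] by [(-1) ^ rho]. If [(-1) ^ rho = 1], inversion is an involution of
    [Phi_i] exchanging the exponents [r] and [f - r], whose only possible
    fixed point is [-1]; this point exists iff [f] is even, and it lies in the
    [Phi_i] with [(-2) ^ rho = w ^ i]. Equality of the [phi_j] for [j >= 1]
    forces [i = 0] by parity when [eps > 2]; when [eps = 2], the identity [(1
    + s) ^ 2 = 2 s] for [s ^ 2 = -1] decides whether [2] is a square. If [rho]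
    is odd and [eps] even then [-1 = w ^ (eps / 2)], so inversion exchanges
    [Phi_0] and [Phi_(eps / 2)]. *)

Import GRing.Theory.

Section Cyclotomy.
Local Open Scope ring_scope.

(** * Counting symmetric sets of exponents, and a congruence modulo 8 *)

(** The reflection [r -> f - r] pairs the exponents below [f / 2] with those above it; only the
    midpoint, an integer exactly for even [f], stays unpaired. The exponent 0 is excluded because
    its reflection leaves the range. *)
Lemma card_symmetric_ord (f : nat) (P : pred nat) :
  (0 < f)%N -> ~~ P 0%N ->
  (forall r, (0 < r < f)%N -> P (f - r)%N = P r) ->
  #|[set r : 'I_f | P r]| =
    (2 * #|[set r : 'I_f | (1 <= r)%N && (2 * r < f)%N & P r]|
     + (~~ odd f && P f./2))%N.
Proof.
case: f => // f _ P0 Psym.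
set S := [set r : 'I_f.+1 | P r].
set A := [set r : 'I_f.+1 | _ & P r].
pose B := [set r : 'I_f.+1 | (f.+1 < 2 * r)%N & P r].
pose M := [set r : 'I_f.+1 | (2 * r)%N == f.+1 & P r].
have Ppos r : P r -> (0 < r)%N by case: r => // Pr; rewrite Pr in P0.
have cardB : #|B| = #|A|.
  (* At [r = 0] the argument is out of range and [inord] falls back to 0, so the facts on [rv]
     assume [0 < r]. *)
  pose rv (r : 'I_f.+1) : 'I_f.+1 := inord (f.+1 - r).
  have rvE (r : 'I_f.+1) : (0 < r)%N -> rv r = (f.+1 - r)%N :> nat.
    by move=> r0; rewrite /rv inordK //; lia.
  have rvrv (r : 'I_f.+1) : (0 < r)%N -> rv (rv r) = r.
    move=> r0; have rf := ltn_ord r; apply: val_inj => /=.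
    by rewrite (rvE (rv r)) (rvE r) //; lia.
  have rvK : {in A, cancel rv rv}.
    by move=> r; rewrite inE => /andP[/andP[r0 _] _]; apply: rvrv.
  rewrite -(card_in_imset (can_in_inj rvK)); apply: eq_card => r.
  apply/idP/imsetP => [|[s]]; rewrite !inE.
    move=> /andP[r2 Pr]; have r0 := Ppos _ Pr; have rf := ltn_ord r.
    exists (rv r); last by rewrite rvrv.
    by rewrite inE rvE // Psym ?r0 // Pr; lia.
  move=> /andP[/andP[s0 s2] Ps] ->; have sf := ltn_ord s.
  by rewrite rvE // Psym ?s0 // Ps; lia.
have cardM : #|M| = (~~ odd f.+1 && P f.+1./2).
  case: (boolP (~~ odd f.+1 && _)) => [/andP[f_even Pf]|].
    have hf : (f.+1./2 < f.+1)%N by lia.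
    rewrite (_ : M = [set Ordinal hf]) ?cards1 //; apply/setP => r.
    rewrite !inE -val_eqE /=; apply/andP/eqP => [[/eqP r2 _]|->]; first lia.
    by split=> //; apply/eqP; lia.
  move=> nP; apply/eqP; rewrite cards_eq0; apply/eqP/setP => r; rewrite !inE.
  apply/andP => -[/eqP r2 Pr]; case/negP: nP.
  have -> : f.+1./2 = r by lia.
  by rewrite Pr andbT; lia.
have -> : S = A :|: B :|: M.
  apply/setP => r; rewrite !inE; case Pr: (P r); last by rewrite !andbF.
  by have := Ppos _ Pr; lia.
rewrite cardsU cardsU -cardM.
have -> : A :&: B = set0.
  by apply/setP => r; rewrite !inE; case: (P r); rewrite ?andbF //; lia.
have -> : (A :|: B) :&: M = set0.
  by apply/setP => r; rewrite !inE; case: (P r); rewrite ?andbF //; lia.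
by rewrite cards0 cardB; lia.
Qed.

(** Meant for [n = rho] and [eps = 2]: it reads the sign of [(-1) ^ (rho / 2)] off [q = 2 rho + 1]
    modulo 8. *)
Lemma odd_half_mod8 (n : nat) :
  ~~ odd n -> odd n./2 = ((2 * n + 1) %% 8 == 5)%N.
Proof.
rewrite -dvdn2 => /dvdnP[m ->]; rewrite muln2 doubleK -{2}(odd_double_half m).
case: (odd m); rewrite /= -!muln2.
  by rewrite (_ : (_ + 1 = m./2 * 8 + 5)%N) ?modnMDl //; lia.
by rewrite (_ : (_ + 1 = m./2 * 8 + 1)%N) ?modnMDl //; lia.
Qed.

(** * Roots of unity and powers in a finite field *)

Lemma prim_root_primitive_element (F : finFieldType) (alpha : {unit F}) :
  primitive_element alpha ->
  (#|F|.-1).-primitive_root (FinRing.uval alpha).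
Proof.
rewrite /primitive_element /generator => /eqP genF.
have ordF : #[alpha]%g = #|F|.-1 by rewrite orderE -genF card_finField_unit.
rewrite -ordF /primitive_root_of_unity order_gt0; apply/forallP => k.
rewrite unity_rootE -FinRing.val_unitX -FinRing.val_unit1 val_eqE.
rewrite -order_dvdn eqn_leq ltn_ord /=; apply/eqP.
apply/idP/idP => [/dvdn_leq->//|].
by move=> le_k; have /eqP-> : k.+1 == #[alpha]%g by rewrite eqn_leq ltn_ord.
Qed.

Lemma prim_root_expr_half (F : fieldType) (n : nat) (z : F) :
  ~~ odd n -> n.-primitive_root z -> z ^+ n./2 = - 1.
Proof.
move=> n_even z_prim; have n_gt0 := prim_order_gt0 z_prim.
have /eqP : (z ^+ n./2) ^+ 2 = 1.
  by rewrite -exprM muln2 even_halfK // (prim_expr_order z_prim).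
rewrite sqrf_eq1 => /orP[|/eqP //].
rewrite -(prim_order_dvd z_prim) => /dvdn_leq.
by move: n_even; lia.
Qed.

Lemma expf_card_pred (F : finFieldType) (x : F) (n : nat) :
  #|F| = (n + 1)%N -> x != 0 -> x ^+ n = 1.
Proof.
move=> cardF x0; apply: (mulfI x0).
by rewrite -exprS -addn1 -cardF expf_card mulr1.
Qed.

(** Raising [(1 + s) ^ 2 = 2 s] to the power [2 t] gives [1 = 2 ^ (2 t) * (-1) ^ t]. This is the
    quadratic character of 2 in a field with [q = 1] modulo 4. *)
Lemma two_expr_quarter (F : finFieldType) (s : F) (t : nat) :
  #|F| = (4 * t + 1)%N -> 2 != 0 :> F -> s ^+ 2 = - 1 ->
  2 ^+ (2 * t) = (- 1) ^+ t :> F.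
Proof.
move=> cardF two0 s2; have s1 : 1 + s != 0.
  apply: contraNneq two0 => s1.
  (* Both summands vanish when [s = -1], which would force [2 = 0]. *)
  have -> : 2 = (1 + s) * (1 - s) + (s ^+ 2 + 1) :> F by ring.
  by rewrite s1 s2 mul0r addNr addr0.
have /eqP := expf_card_pred _ _ _ cardF s1.
have -> : (4 * t = 2 * (2 * t))%N by lia.
have -> : (1 + s) ^+ (2 * (2 * t)) = 2 ^+ (2 * t) * (s ^+ 2) ^+ t.
  rewrite -exprM -exprMn exprM; congr (_ ^+ _).
  by rewrite sqrrD s2 expr1n; ring.
rewrite s2 => /eqP eq1; apply: (mulIf (_ : (- 1) ^+ t != 0)).
  by rewrite expf_neq0 // oppr_eq0 oner_eq0.
by rewrite eq1 -exprMn mulrNN mulr1 expr1n.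
Qed.

Lemma prim_root_expr_cofactor (F : finFieldType) (alpha : {unit F})
    (d m : nat) :
  primitive_element alpha -> #|F| = (d * m + 1)%N ->
  m.-primitive_root (FinRing.uval alpha ^+ d).
Proof.
move=> /prim_root_primitive_element + cardF.
rewrite cardF addn1 /= => a_prim.
have m_gt0 : (0 < m)%N by have := prim_order_gt0 a_prim; lia.
by have := dvdn_prim_root a_prim (dvdn_mull d (dvdnn m)); rewrite mulnK.
Qed.

(** The class is generated by [alpha ^ d], a primitive [m]-th root of unity, so membership becomes
    an equation. *)
Lemma cyclotomic_class0E (F : finFieldType) (alpha : {unit F}) (d m : nat)
    (x : F) :
  primitive_element alpha -> #|F| = (d * m + 1)%N ->
  (x \in cyclotomic_class alpha d 0) = (x ^+ m == 1).
Proof.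
move=> alpha_prim cardF.
have ad_prim := prim_root_expr_cofactor _ _ _ _ alpha_prim cardF.
apply/imsetP/eqP => [[u]|xm1].
  case/cycleP=> k -> ->; rewrite expg0 mul1g !FinRing.val_unitX.
  by rewrite -[LHS]exprM mulnC exprM (prim_expr_order ad_prim) expr1n.
have [k ->] := prim_rootP ad_prim xm1.
exists ((alpha ^+ d) ^+ k)%g; first exact: mem_cycle.
by rewrite expg0 mul1g !FinRing.val_unitX.
Qed.

(** * The sets [Phi_i] under inversion *)

Section PrimitiveElement.
Variables (F : finFieldType) (alpha : {unit F}) (e f eps rho : nat).
Hypothesis alpha_prim : primitive_element alpha.
Hypothesis cardFe : #|F| = (e * f + 1)%N.
Hypothesis cardFeps : #|F| = (eps * rho + 1)%N.
Hypotheses (f_gt1 : (1 < f)%N) (eps_gt1 : (1 < eps)%N).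
Hypothesis eps_dvd_e : (eps %| e)%N.

Local Notation a := (FinRing.uval alpha).
Local Notation w := (a ^+ rho).

Lemma rho_gt0 : (0 < rho)%N.
Proof.
by have := finNzRing_gt1 F; rewrite cardFeps; case: (rho) => //; rewrite muln0.
Qed.

Lemma w_prim : eps.-primitive_root w.
Proof. by apply: prim_root_expr_cofactor => //; rewrite mulnC. Qed.

Lemma uval_neq0 : a != 0.
Proof. by rewrite -unitfE; apply: valP. Qed.

Lemma mem_PhiE (i : nat) (x : F) :
  (x \in Phi alpha e eps i) = (x ^+ f == 1) && ((x - 1) ^+ rho == w ^+ i).
Proof.
have ai0 : a ^+ i != 0 by rewrite expf_neq0 ?uval_neq0.
rewrite inE (cyclotomic_class0E _ _ _ _ _ alpha_prim cardFe).
case: eqP => //= _.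
have -> : (x - 1 \in [set a ^+ i * y | y in cyclotomic_class alpha eps 0])
          = ((x - 1) ^+ rho == w ^+ i).
  rewrite exprAC; apply/imsetP/eqP => [[y]|xw].
    rewrite (cyclotomic_class0E _ _ _ _ _ alpha_prim cardFeps) => /eqP y1 ->.
    by rewrite exprMn y1 mulr1.
  exists ((x - 1) / a ^+ i); last by rewrite mulrC divfK.
  rewrite (cyclotomic_class0E _ _ _ _ _ alpha_prim cardFeps) expr_div_n xw.
  by rewrite divff ?expf_neq0 ?uval_neq0.
(* At [x = 1] the second equation would read [0 = w ^ i], so the two equations already encode
   [x != 1]. *)
case: eqP => //= ->; apply/esym/negbTE.
by rewrite subrr expr0n gtn_eqF ?rho_gt0 //= eq_sym !expf_neq0 ?uval_neq0.
Qed.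

Lemma dvdn_f_rho : (f %| rho)%N.
Proof.
(* From [e * f = eps * rho] and [e = k * eps] follows [rho = k * f]. *)
case/dvdnP: eps_dvd_e => k ek; apply/dvdnP; exists k.
apply/eqP; rewrite -(eqn_pmul2l (ltnW eps_gt1)).
by move: cardFe; rewrite cardFeps ek; lia.
Qed.

Lemma subr1_inv_expr (x : F) :
  x ^+ f = 1 -> (x^-1 - 1) ^+ rho = (- 1) ^+ rho * (x - 1) ^+ rho.
Proof.
move=> xf; have x0 : x != 0.
  apply/eqP => x0; move/eqP: xf; rewrite x0 expr0n.
  by rewrite gtn_eqF ?(ltnW f_gt1) //= eq_sym oner_eq0.
have xrho : x ^+ rho = 1.
  by case/dvdnP: dvdn_f_rho => k ->; rewrite mulnC exprM xf expr1n.
have -> : x^-1 - 1 = - 1 * (x - 1) * x^-1 by field.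
by rewrite !exprMn exprVn xrho invr1 mulr1.
Qed.

(** Two indices allow both uses: [i = j] when [(-1) ^ rho = 1], and the exchange of 0 with [eps / 2]
    when [(-1) ^ rho = -1]. *)
Lemma mem_PhiV (i j : nat) (x : F) :
  (- 1) ^+ rho * w ^+ i = w ^+ j ->
  (x^-1 \in Phi alpha e eps j) = (x \in Phi alpha e eps i).
Proof.
move=> ij; rewrite !mem_PhiE exprVn invr_eq1.
case: eqP => //= /subr1_inv_expr ->.
by rewrite -ij (inj_eq (mulfI _)) // expf_neq0 // oppr_eq0 oner_eq0.
Qed.

Lemma phi_inv (i j : nat) :
  (- 1) ^+ rho * w ^+ i = w ^+ j -> phi alpha e eps i = phi alpha e eps j.
Proof.
move=> ij; rewrite /phi -(card_imset _ (@invr_inj F)); apply: eq_card => x.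
apply/imsetP/idP => [[y yi ->]|xj]; first by rewrite (mem_PhiV _ _ _ ij).
by exists x^-1; rewrite ?invrK // -(mem_PhiV _ _ _ ij) invrK.
Qed.

(** The map [r -> alpha ^ (r e)] is a bijection from ['I_f] onto the [f]-th roots of unity; this
    moves the count to exponents, where [Psi] lives. *)
Lemma phi_eq_card_ord (i : nat) :
  phi alpha e eps i = #|[set r : 'I_f | a ^+ (r * e) \in Phi alpha e eps i]|.
Proof.
have ae_prim := prim_root_expr_cofactor _ _ _ _ alpha_prim cardFe.
pose g (r : 'I_f) := a ^+ (r * e).
have g_inj : injective g.
  move=> r s; rewrite /g ![(_ * e)%N]mulnC !exprM => /eqP.
  by rewrite (eq_prim_root_expr ae_prim) !modn_small // => /eqP /val_inj.
rewrite -(card_imset _ g_inj); apply: eq_card => x.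
apply/idP/imsetP => [xP|[r]]; last by rewrite inE => rP ->.
have /eqP xf : x ^+ f == 1 by move: xP; rewrite mem_PhiE => /andP[].
have [r xr] := prim_rootP ae_prim xf.
have xg : x = g r by rewrite xr /g mulnC exprM.
by exists r => //; rewrite inE -/(g r) -xg.
Qed.

Lemma expr_half_f : ~~ odd f -> a ^+ (f./2 * e) = - 1.
Proof.
move=> f_even; rewrite mulnC exprM.
exact: prim_root_expr_half (prim_root_expr_cofactor _ _ _ _ alpha_prim cardFe).
Qed.

(** The boolean term says that [-1], the element at the midpoint exponent [f / 2], lies in [Phi_i];
    the [-2] is [-1 - 1]. *)
Lemma phi_psi (i : nat) :
  (- 1) ^+ rho = 1 :> F ->
  phi alpha e eps i =
    (2 * psi alpha e f eps i + (~~ odd f && ((- 2) ^+ rho == w ^+ i :> F)))%N.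
Proof.
move=> sgn; rewrite phi_eq_card_ord.
pose P (r : nat) := a ^+ (r * e) \in Phi alpha e eps i.
have f_gt0 := ltnW f_gt1.
rewrite (card_symmetric_ord f P f_gt0).
- congr (_ + nat_of_bool _)%N; case: (boolP (odd f)) => //= f_even.
  rewrite /P expr_half_f // mem_PhiE -opprD.
  by rewrite -signr_odd (negbTE f_even) eqxx.
- rewrite /P mul0n expr0 mem_PhiE subrr expr0n gtn_eqF ?rho_gt0 //=.
  by rewrite negb_and orbC eq_sym !expf_neq0 ?uval_neq0.
move=> r /andP[r0 rf]; rewrite /P -(mem_PhiV i i (a ^+ (r * e))) ?sgn ?mul1r //.
suff -> : a ^+ ((f - r) * e) = (a ^+ (r * e))^-1 by [].
apply: (mulfI (expf_neq0 (r * e) uval_neq0)).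
rewrite divff ?expf_neq0 ?uval_neq0 // -exprD -mulnDl subnKC ?(ltnW rf) //.
rewrite mulnC exprM; apply: prim_expr_order.
exact: prim_root_expr_cofactor cardFe.
Qed.

(** * Which [Phi_i] contains [-1] *)

Lemma two_neq0 : ~~ odd f -> 2 != 0 :> F.
Proof.
have ae_prim := prim_root_expr_cofactor _ _ _ _ alpha_prim cardFe.
(* A primitive root of unity of even order [f] excludes characteristic 2. *)
by move=> f_even; rewrite (prim_root_dvd_eq0 ae_prim) // dvdn2.
Qed.

(** Here [w = -1] and [q = 4 (rho / 2) + 1], so [alpha ^ (rho / 2)] is a square root of [-1] and the
    formula for [2 ^ rho] applies. *)
Lemma minus2_expr_eps2 :
  ~~ odd f -> eps = 2%N -> ~~ odd rho -> (- 2) ^+ rho = w ^+ odd rho./2 :> F.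
Proof.
move=> f_even eps2 rho_even.
have -> : w = - 1.
  have := w_prim; rewrite eps2 => /(prim_root_expr_half _ 2 _ isT).
  by rewrite expr1.
have rhoE : rho = (2 * rho./2)%N by move: rho_even; lia.
rewrite -mulN1r exprMn -signr_odd (negbTE rho_even) mul1r signr_odd rhoE.
rewrite -[in RHS]rhoE; apply: (two_expr_quarter _ (a ^+ rho./2)).
- by rewrite cardFeps eps2; lia.
- exact: two_neq0.
have -> : (a ^+ rho./2) ^+ 2 = a ^+ (eps * rho)./2.
  by rewrite -exprM eps2; congr (_ ^+ _); lia.
apply: prim_root_expr_half; first by rewrite eps2; lia.
by rewrite -[a]expr1; apply: prim_root_expr_cofactor => //; rewrite mul1n.
Qed.

(* [-1] lies in exactly one [Phi_i], the only one of odd cardinality. *)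
Lemma minus2_expr_eq1 :
  ~~ odd f -> (2 < eps)%N -> (- 1) ^+ rho = 1 :> F ->
  (forall j : nat, (1 <= j <= eps - 1)%N ->
     phi alpha e eps 1 = phi alpha e eps j) ->
  (- 2) ^+ rho = 1 :> F.
Proof.
move=> f_even eps_gt2 sgn phi_eq.
have m2_eps : ((- 2) ^+ rho) ^+ eps = 1 :> F.
  rewrite -exprM mulnC; apply: expf_card_pred => //.
  by rewrite oppr_eq0 two_neq0.
have [[i i_lt] /= iE] := prim_rootP w_prim m2_eps.
case: (posnP i) => [i0|i_gt0]; first by rewrite iE i0 expr0.
(* As [eps > 2], a second nonzero index exists; [phi_j] is then even and [phi_i] odd, against their
   equality. *)
have [j j_lt j_neq_i] : exists2 j, (1 <= j < eps)%N & j != i.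
  by exists (if i == 1%N then 2%N else 1%N); case: (i =P 1%N); lia.
have phi_ij : phi alpha e eps i = phi alpha e eps j.
  by rewrite -(phi_eq i) ?(phi_eq j) //; lia.
move: phi_ij; rewrite !phi_psi // f_even iE eqxx.
rewrite (eq_prim_root_expr w_prim) !modn_small //; last by case/andP: j_lt.
by rewrite eq_sym (negbTE j_neq_i) /=; lia.
Qed.

End PrimitiveElement.
End Cyclotomy.

Theorem theorem3p16 (q : nat) (F : finFieldType) (hF : #|F| = q)
    (alpha : {unit F}) (halpha : primitive_element alpha)
    (e f eps rho : nat)
    (he : 1 < e) (hf : 1 < f) (heps : 1 < eps) (hrho : 1 < rho)
    (hqe : q = e * f + 1) (hqeps : q = eps * rho + 1) (hdvd : eps %| e) :
  (* (a) *)
  (q = 1 %[mod 2 * eps] ->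
   (forall j : nat, 1 <= j <= eps - 1 -> phi alpha e eps 1 = phi alpha e eps j) ->
   [/\ odd f ->
         phi alpha e eps 0 = 2 * psi alpha e f eps 0 /\
         phi alpha e eps 1 = 2 * psi alpha e f eps 1,
       ~~ odd f -> 2 < eps ->
         phi alpha e eps 0 = 2 * psi alpha e f eps 0 + 1 /\
         phi alpha e eps 1 = 2 * psi alpha e f eps 1,
       ~~ odd f -> eps = 2 -> q = 1 %[mod 8] ->
         phi alpha e eps 0 = 2 * psi alpha e f eps 0 + 1 /\
         phi alpha e eps 1 = 2 * psi alpha e f eps 1
     & ~~ odd f -> eps = 2 -> q = 5 %[mod 8] ->
         phi alpha e eps 0 = 2 * psi alpha e f eps 0 /\
         phi alpha e eps 1 = 2 * psi alpha e f eps 1 + 1]) /\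
  (* (b) *)
  (q = eps + 1 %[mod 2 * eps] -> odd eps ->
   (forall j : nat, 1 <= j <= eps - 1 -> phi alpha e eps 1 = phi alpha e eps j) ->
   phi alpha e eps 0 = 2 * psi alpha e f eps 0 /\
   phi alpha e eps 1 = 2 * psi alpha e f eps 1) /\
  (* (c) *)
  (q = eps + 1 %[mod 2 * eps] -> ~~ odd eps ->
   phi alpha e eps 0 = phi alpha e eps (eps %/ 2)).
Proof.
have cardFe : #|F| = e * f + 1 by rewrite hF.
have cardFeps : #|F| = eps * rho + 1 by rewrite hF.
have wP := w_prim F alpha eps rho halpha cardFeps.
have phiE i := phi_psi F alpha e f eps rho halpha cardFe cardFeps hf heps hdvd i.
have w01 : ((FinRing.uval alpha ^+ rho) ^+ 0 ==
            (FinRing.uval alpha ^+ rho) ^+ 1)%R = false.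
  by rewrite (eq_prim_root_expr wP) !modn_small // ltnW.
(* Since [q - 1 = eps * rho], the congruence modulo [2 * eps] fixes the parity of [rho]. *)
have rho_even : q = 1 %[mod 2 * eps] -> ~~ odd rho.
  rewrite hqeps => /eqP; rewrite -[X in _ == X %[mod _]]add0n eqn_modDr mod0n.
  by rewrite -/(dvdn _ _) (mulnC eps) dvdn_pmul2r ?(ltnW heps) // dvdn2.
have rho_odd : q = eps + 1 %[mod 2 * eps] -> odd rho.
  rewrite hqeps => /eqP; rewrite eqn_modDr -[X in _ == X %[mod _]]muln1.
  rewrite (mulnC 2) -!muln_modr.
  by rewrite eqn_pmul2l ?(ltnW heps) // modn2; case: (odd rho).
split=> [/rho_even rho0 phi_eq|].
  have sgn : ((- 1) ^+ rho = 1 :> F)%R by rewrite -signr_odd (negbTE rho0).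
  (* The boolean [b], read as 0 or 1, is the index of the set containing [-1]; that set gains the
     extra element. *)
  have parity (b : bool) : ~~ odd f ->
      ((- 2) ^+ rho = (FinRing.uval alpha ^+ rho) ^+ b :> F)%R ->
      phi alpha e eps 0 = 2 * psi alpha e f eps 0 + ~~ b /\
      phi alpha e eps 1 = 2 * psi alpha e f eps 1 + b.
    move=> f_even m2; rewrite !phiE // f_even m2 /=.
    by case: b {m2}; rewrite eqxx ?w01 1?eq_sym ?w01.
  split=> [f_odd|f_even eps_gt2|f_even eps2 q8|f_even eps2 q8].
  - by rewrite !phiE // f_odd !addn0.
  - have := parity false f_even; rewrite addn0; apply.
    exact: (minus2_expr_eq1 F alpha e f eps rho).
  - have := parity false f_even; rewrite addn0; apply.
    rewrite (minus2_expr_eps2 F alpha e f eps rho) //.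
    by rewrite odd_half_mod8 // (_ : 2 * rho + 1 = q) ?q8 // hqeps eps2.
  have := parity true f_even; rewrite addn0; apply.
  rewrite (minus2_expr_eps2 F alpha e f eps rho) //.
  by rewrite odd_half_mod8 // (_ : 2 * rho + 1 = q) ?q8 // hqeps eps2.
split=> [/rho_odd rho1 eps_odd phi_eq|/rho_odd rho1 eps_even].
  (* With [eps] and [rho] odd, [q] is even: then [f] is odd, and [-1 = (-1) ^ q = 1] makes the sign
     trivial. *)
  have q_even : ~~ odd #|F| by rewrite cardFeps oddD oddM eps_odd rho1.
  have f_odd : odd f.
    by move: q_even; rewrite cardFe oddD oddM; case: (odd f); rewrite ?andbF.
  have sgn : ((- 1) ^+ rho = 1 :> F)%R.
    rewrite -signr_odd rho1 expr1 -{1}[(- 1)%R]expf_card.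
    by rewrite -signr_odd (negbTE q_even).
  by rewrite !phiE // f_odd !addn0.
(* The sign [(-1) ^ rho = -1] equals [w ^ (eps / 2)], so inversion carries [Phi_0] onto
   [Phi_(eps / 2)]. *)
apply: (phi_inv F alpha e f eps rho) => //.
rewrite expr0 mulr1 -signr_odd rho1 expr1 divn2.
by rewrite (prim_root_expr_half _ _ _ eps_even wP).
Qed.
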